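(* Suppose the polynomials $Q_n(x)$, $n\ge 0$, are orthogonal with respect to a nondegenerate linear functional $\tau$, i.e. $\langle \tau, Q_n Q_m\rangle = \tilde h_n\,\delta_{nm}$ with all $\tilde h_n\neq 0$. Then there is exactly one sequence of nonzero numbers $\nu_1,\nu_2,\dots$ such that the linear operator $\mathcal R$ defined by $\mathcal R Q_n = \nu_{n+1}P_{n+1}$ ($n\ge 0$) satisfies $$\langle \tau, g(x)\,\mathcal D f(x)\rangle = \langle \sigma, f(x)\,\mathcal R g(x)\rangle$$ for every pair of polynomials $f(x),g(x)$; it is given by $$\nu_{n+1} = \frac{\mu_{n+1}\,\tilde h_n}{h_{n+1}},\qquad n=0,1,2,\dots$$
   Context: All polynomials have complex coefficients. A linear functional $\sigma$ on polynomials is given by its moments $g_n=\langle\sigma,x^n\rangle$ with $g_0=1$, and is nondegenerate: all Hankel determinants $\det|g_{i+k}|_{i,k=0}^{n-1}$, $n\ge1$, are nonzero. $P_n(x)=x^n+O(x^{n-1})$ are the monic orthogonal polynomials: $\langle\sigma,P_nP_m\rangle=h_n\delta_{nm}$ with all $h_n\ne0$. A generalized derivative operator $\mathcal D$ is the linear operator on polynomials with $\mathcal D x^n=\mu_n x^{n-1}$, where $\mu_n$ are complex numbers with $\mu_0=0$ and $\mu_n\neq0$ for $n\ge1$. The derived monic polynomials are $Q_n(x)=\mu_{n+1}^{-1}\mathcal D P_{n+1}(x)$, $n\ge 0$. For any sequence of nonzero $\nu_1,\nu_2,\dots$ there is a unique linear operator $\mathcal R$ with $\mathcal R Q_n=\nu_{n+1}P_{n+1}$;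 it acts on monomials as $\mathcal R x^n=\nu_{n+1}x^{n+1}+R_{nn}x^n+\dots+R_{n0}$. *)

(* Defs.v *)
From HB Require Import structures.
From mathcomp Require Import all_boot all_order all_algebra.
From mathcomp Require Import reals complex.

Set Implicit Arguments.
Unset Strict Implicit.
Unset Printing Implicit Defensive.

Import GRing.Theory.
Local Open Scope ring_scope.

Section Defs.
Variable C : fieldType.
Implicit Types (L : {scalar {poly C}}) (P : nat -> {poly C}) (mu : nat -> C).

Definition moment L (n : nat) : C := L 'X^n.

Definition hankel_nondegenerate L : Prop :=
  forall n : nat, (0 < n)%N ->
    \det (\matrix_(i < n, k < n) moment L (i + k)) != 0.

Definition orthogonal_family L P (h : nat -> C) : Prop :=
  (forall n m : nat, L (P n * P m) = h n * (n == m)%:R) /\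
  (forall n : nat, h n != 0).

Definition monic_orthogonal L P (h : nat -> C) : Prop :=
  (forall n : nat, P n \is monic /\ size (P n) = n.+1) /\ orthogonal_family L P h.

(* The linear operator with 'X^n |-> mu n *: 'X^(n - 1). The truncated exponent
   at n = 0 is harmless since mu 0 = 0 wherever this operator is used. *)
Definition gderiv mu (p : {poly C}) : {poly C} :=
  \sum_(i < size p) p`_i *: (mu i *: 'X^(i.-1)).

Lemma gderivE mu (p : {poly C}) (n : nat) : (size p <= n)%N ->
  gderiv mu p = \sum_(i < n) p`_i *: (mu i *: 'X^(i.-1)).
Proof.
move=> le_pn; rewrite /gderiv (big_ord_widen n (fun i => p`_i *: (mu i *: 'X^(i.-1))) le_pn).
rewrite big_mkcond; apply: eq_bigr => i _.
by case: ltnP => // le_pi; rewrite nth_default // scale0r.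
Qed.

Lemma gderivXn mu (n : nat) : gderiv mu 'X^n = mu n *: 'X^(n.-1).
Proof.
rewrite /gderiv size_polyXn big_ord_recr /= coefXn eqxx scale1r big1 ?add0r //.
by move=> i _; rewrite coefXn (ltn_eqF (ltn_ord i)) scale0r.
Qed.

Fact gderiv_is_linear mu : linear (gderiv mu).
Proof.
move=> a p q; set n := maxn (size p) (size q).
have le_n : (size (a *: p + q)%R <= n)%N.
  by rewrite (leq_trans (size_polyD _ _)) // geq_max leq_maxr andbT
             (leq_trans (size_scale_leq _ _)) // leq_maxl.
rewrite (gderivE mu le_n) (gderivE mu (leq_maxl _ _ : (size p <= n)%N)).
rewrite (gderivE mu (leq_maxr _ _ : (size q <= n)%N)) scaler_sumr -big_split /=.
by apply: eq_bigr => i _; rewrite coefD coefZ scalerDl scalerA.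
Qed.

HB.instance Definition _ mu :=
  GRing.isLinear.Build C {poly C} {poly C} *:%R (gderiv mu) (gderiv_is_linear mu).

Definition derived mu P (n : nat) : {poly C} :=
  (mu n.+1)^-1 *: gderiv mu (P n.+1).

(* The sequence nu_1, nu_2, ... is indexed from 0: nu n stands for nu_(n+1).
   The operator is quantified existentially; it is unique because the derived
   polynomials have degrees 0, 1, 2, ... and hence form a basis. *)
Definition intertwining (sigma tau : {scalar {poly C}}) mu P (nu : nat -> C) :
    Prop :=
  (forall n : nat, nu n != 0) /\
  exists Rop : {linear {poly C} -> {poly C}},
    (forall n : nat, Rop (derived mu P n) = nu n *: P n.+1) /\
    (forall f g : {poly C}, tau (g * gderiv mu f) = sigma (f * Rop g)).

End Defs.

(* Main.v *)
Require Import Defs.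
From HB Require Import structures.
From mathcomp Require Import all_boot all_order all_algebra.
From mathcomp Require Import boolp reals complex.

Set Implicit Arguments.
Unset Strict Implicit.
Unset Printing Implicit Defensive.

Import GRing.Theory.
Local Open Scope ring_scope.

(** Both sides of the adjunction formula are bilinear in (f, g), and the monic
    families P_m and Q_n have degrees m and n, so each is a basis of the
    polynomials; the formula therefore holds for all f and g if and only if it
    holds for f = P_m and g = Q_n. There both sides are diagonal:
      tau (Q_n * D P_m) = mu_m ht_n if m = n + 1 and 0 otherwise, because
    D P_m = mu_m Q_(m-1), while
      sigma (P_m * R Q_n) = nu_n h_(n+1) if m = n + 1 and 0 otherwise.
    The formula thus amounts to mu_(n+1) ht_n = nu_n h_(n+1) for all n, which
    has the announced nonzero solution and no other
    ([intertwining_nuE], [intertwining_solution]).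

    The operator R itself is written with the reproducing kernel of tau: the
    n-th coordinate of g in the basis Q is tau (Q_n * g) / ht_n
    ([orthogonal_linear_extension]). *)

Section Adjunction.
Variable C : fieldType.
Implicit Types (L : {scalar {poly C}}) (P Q : nat -> {poly C}) (mu : nat -> C).

(** Induction on degree, in place of an expansion in the basis P: subtracting
    the leading coefficient times P_n lowers the size. The bound n matters, since
    orthogonality arguments only control the members of degree below n. *)
Lemma monic_basis_ind P (K : {poly C} -> Prop) (n : nat) :
    (forall i, P i \is monic /\ size (P i) = i.+1) ->
    K 0 -> (forall a (p q : {poly C}), K p -> K q -> K (a *: p + q)) ->
    (forall i, (i < n)%N -> K (P i)) ->
  forall p : {poly C}, (size p <= n)%N -> K p.
Proof.
move=> monP K0 KD; elim: n => [|n IHn] KP p le_pn.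
  by move: le_pn; rewrite leqn0 size_poly_eq0 => /eqP->.
have [/monicP lcP szP] := monP n.
have -> : p = p`_n *: P n + (p - p`_n *: P n) by rewrite addrC subrK.
apply: KD; first exact: KP.
apply: IHn => [i lt_in|]; first by apply: KP; apply: ltnW.
apply/leq_sizeP => j le_nj; rewrite coefB coefZ.
move: le_nj; rewrite leq_eqVlt => /predU1P[<-|lt_nj].
  by move: lcP; rewrite lead_coefE szP /= => ->; rewrite mulr1 subrr.
by rewrite (leq_sizeP _ _ le_pn j lt_nj) [(P n)`_j]nth_default ?szP // mulr0 subr0.
Qed.

Lemma orthogonal_low_degree L P (h : nat -> C) (n : nat) (p : {poly C}) :
  monic_orthogonal L P h -> (size p <= n)%N -> L (P n * p) = 0.
Proof.
move=> [monP [orthP _]].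
apply: (monic_basis_ind (K := fun p => L (P n * p) = 0) monP).
- by rewrite mulr0 linear0.
- by move=> a q r Lq Lr; rewrite mulrDr -scalerAr linearP /= Lq Lr mulr0 addr0.
- by move=> i lt_in; rewrite orthP gtn_eqF // mulr0.
Qed.

(** The coordinates of g in an orthogonal basis are the Fourier coefficients
    L (Q_n * g) / h_n, which vanish for n >= size g; truncating the expansion at
    any length at least size g thus gives the same value, whence linearity. *)
Lemma orthogonal_linear_extension L Q (h : nat -> C) (T : nat -> {poly C}) :
    monic_orthogonal L Q h ->
  exists F : {linear {poly C} -> {poly C}}, forall n, F (Q n) = T n.
Proof.
move=> orthLQ; have [monQ [orthQ h_neq0]] := orthLQ.
pose F (g : {poly C}) := \sum_(i < size g) (L (Q i * g) / h i) *: T i.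
have FE (g : {poly C}) n : (size g <= n)%N -> F g = \sum_(i < n) (L (Q i * g) / h i) *: T i.
  move=> le_gn; rewrite /F.
  rewrite (big_ord_widen n (fun i => (L (Q i * g) / h i) *: T i) le_gn).
  rewrite big_mkcond; apply: eq_bigr => i _; case: ltnP => // le_gi.
  by rewrite (orthogonal_low_degree orthLQ le_gi) mul0r scale0r.
have F_linear : linear F.
  move=> a p q; set n := maxn (size p) (size q).
  have le_n : (size (a *: p + q)%R <= n)%N.
    rewrite (leq_trans (size_polyD _ _)) // geq_max leq_maxr andbT.
    by rewrite (leq_trans (size_scale_leq _ _)) // leq_maxl.
  rewrite (FE _ _ le_n) (FE _ _ (leq_maxl _ _ : size p <= n)%N).
  rewrite (FE _ _ (leq_maxr _ _ : size q <= n)%N) scaler_sumr -big_split /=.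
  apply: eq_bigr => i _.
  by rewrite mulrDr -scalerAr linearP /= mulrDl scalerDl scalerA mulrA.
pose Flin : {linear {poly C} -> {poly C}} :=
  HB.pack F (GRing.isLinear.Build C {poly C} {poly C} *:%R F F_linear).
exists Flin => n; rewrite /= /F (monQ n).2 big_ord_recr /= big1 => [|i _].
  by rewrite add0r orthQ eqxx mulr1 divff // scale1r.
by rewrite orthQ ltn_eqF // mulr0 mul0r scale0r.
Qed.

Lemma coef_gderiv mu (p : {poly C}) (i : nat) :
  mu 0%N = 0 -> (gderiv mu p)`_i = mu i.+1 * p`_i.+1.
Proof.
move=> mu0; rewrite (gderivE mu (leq_maxl _ i.+2)) coef_sum.
have lt_i : (i.+1 < maxn (size p) i.+2)%N by rewrite leq_max leqnn orbT.
rewrite (bigD1 (Ordinal lt_i)) //= !coefZ coefXn eqxx mulr1 big1 => [|j ne_ji].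
  by rewrite addr0 mulrC.
rewrite !coefZ coefXn; case: j ne_ji => [[|j] lt_j] /=.
  by rewrite mu0 mul0r mulr0.
by rewrite -val_eqE /= eqSS eq_sym => /negPf->; rewrite !mulr0.
Qed.

Lemma derived_monic mu P (n : nat) :
    mu 0%N = 0 -> mu n.+1 != 0 -> P n.+1 \is monic -> size (P n.+1) = n.+2 ->
  derived mu P n \is monic /\ size (derived mu P n) = n.+1.
Proof.
move=> mu0 mu_neq0 /monicP lcP szP.
have Qn : (derived mu P n)`_n = 1.
  rewrite coefZ coef_gderiv // mulKf //.
  by move: lcP; rewrite lead_coefE szP.
have szQ : size (derived mu P n) = n.+1.
  apply/eqP; rewrite eqn_leq; apply/andP; split.
    apply/leq_sizeP => j lt_nj; rewrite coefZ coef_gderiv //.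
    by rewrite [(P n.+1)`_j.+1]nth_default ?szP // !mulr0.
  rewrite ltnNge; apply/negP => /leq_sizeP/(_ n (leqnn n))/eqP.
  by rewrite Qn oner_eq0.
by split=> //; rewrite monicE lead_coefE szQ Qn.
Qed.

Section Solution.
Variables (sigma tau : {scalar {poly C}}) (P : nat -> {poly C}).
Variables (mu h ht : nat -> C).
Hypothesis P_orth : monic_orthogonal sigma P h.
Hypothesis mu0 : mu 0%N = 0.
Hypothesis mu_neq0 : forall n : nat, (0 < n)%N -> mu n != 0.
Hypothesis Q_orth : orthogonal_family tau (derived mu P) ht.

Lemma derived_gderiv_pairing n m :
  tau (derived mu P n * gderiv mu (P m.+1)) = mu m.+1 * (ht n * (n == m)%:R).
Proof.
have -> : gderiv mu (P m.+1) = mu m.+1 *: derived mu P m.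
  by rewrite /derived scalerA divff ?mu_neq0 // scale1r.
by rewrite -scalerAr linearZ /= (Q_orth.1 n m).
Qed.

Lemma orthogonal_scaled_pairing (a : C) n m :
  sigma (P m * (a *: P n)) = a * (h m * (m == n)%:R).
Proof. by rewrite -scalerAr linearZ /= (P_orth.2.1 m n). Qed.

(** The case f = P_(n+1), g = Q_n of the formula alone determines nu_n. *)
Lemma intertwining_nuE (nu : nat -> C) :
  intertwining sigma tau mu P nu -> forall n, nu n = mu n.+1 * ht n / h n.+1.
Proof.
move=> [_ [F [FQ adjF]]] n; have := adjF (P n.+1) (derived mu P n).
rewrite FQ derived_gderiv_pairing orthogonal_scaled_pairing !eqxx !mulr1 => ->.
by rewrite mulfK // P_orth.2.2.
Qed.

Lemma intertwining_solution :
  intertwining sigma tau mu P (fun n => mu n.+1 * ht n / h n.+1).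
Proof.
have [monP [_ h_neq0]] := P_orth; have [_ ht_neq0] := Q_orth.
have monQ n : derived mu P n \is monic /\ size (derived mu P n) = n.+1.
  by have [? ?] := monP n.+1; apply: derived_monic => //; apply: mu_neq0.
set nu := fun n => _; split=> [n|].
  by rewrite /nu mulf_neq0 ?invr_eq0 ?mulf_neq0 ?mu_neq0.
have [F FQ] := orthogonal_linear_extension (fun n => nu n *: P n.+1)
                 (conj monQ Q_orth).
exists F; split=> // f g.
apply: (monic_basis_ind
  (K := fun g => tau (g * gderiv mu f) = sigma (f * F g)) monQ) (leqnn _).
- by rewrite mul0r !linear0 mulr0 linear0.
- move=> a p q Kp Kq.
  by rewrite mulrDl -scalerAl !linearP /= Kp Kq mulrDr -scalerAr linearP.
move=> n _; rewrite FQ.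
apply: (monic_basis_ind
  (K := fun f => tau (derived mu P n * gderiv mu f)
                 = sigma (f * (nu n *: P n.+1))) monP) (leqnn _).
- by rewrite linear0 mulr0 mul0r !linear0.
- move=> a p q Kp Kq.
  by rewrite linearP mulrDr -scalerAr linearP /= Kp Kq mulrDl -scalerAl linearP.
move=> [|m] _.
  (* D annihilates the constant P_0, since mu_0 = 0. *)
  have -> : gderiv mu (P 0%N) = 0.
    apply/polyP => i; rewrite coef_gderiv // coef0 nth_default ?mulr0 //.
    by rewrite (monP 0%N).2.
  by rewrite mulr0 linear0 orthogonal_scaled_pairing !mulr0.
rewrite derived_gderiv_pairing orthogonal_scaled_pairing eqSS eq_sym.
by case: eqP => [->|_]; rewrite ?mulr0 // !mulr1 /nu divfK.
Qed.

End Solution.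

End Adjunction.

Theorem proposition1 (R : realType)
    (sigma tau : {scalar {poly R[i]}})
    (P : nat -> {poly R[i]}) (mu h ht : nat -> R[i])
    (sigma1 : moment sigma 0 = 1)
    (sigma_nondeg : hankel_nondegenerate sigma)
    (P_orth : monic_orthogonal sigma P h)
    (mu0 : mu 0%N = 0)
    (mu_neq0 : forall n : nat, (0 < n)%N -> mu n != 0)
    (tau_nondeg : hankel_nondegenerate tau)
    (Q_orth : orthogonal_family tau (derived mu P) ht) :
  exists nu : nat -> R[i],
    unique (intertwining sigma tau mu P) nu /\
    (forall n : nat, nu n = mu n.+1 * ht n / h n.+1).
Proof.
exists (fun n => mu n.+1 * ht n / h n.+1); split=> //; split.
  exact: intertwining_solution.
move=> nu nuP; apply/funext => n.
by rewrite (intertwining_nuE P_orth mu_neq0 Q_orth nuP).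
Qed.
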